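(* Let $m>1$ be an integer, let $F_m$ be the free group of rank $m$, and let $X$ be a finite generating set of $F_m$. Then $\max \mathrm{D}_{F_m,X}(n)\not\preceq \log(n)$; that is, the relation $\max \mathrm{D}_{F_m,X}(n)\preceq \log(n)$ does not hold.
   Context: For a residually finite group $\Gamma$ with finite generating set $X$ and word length $\|\cdot\|_X$, and for nontrivial $\gamma\in\Gamma$, let $\mathrm{D}_\Gamma(\gamma)=\min\{[\Gamma:\Delta] : \Delta\le\Gamma \text{ a finite index subgroup},\ \gamma\notin\Delta\}$ (the subgroups $\Delta$ are not required to be normal). Then $\max\mathrm{D}_{\Gamma,X}(n)$ denotes the maximum of $\mathrm{D}_\Gamma(\gamma)$ over all nontrivial $\gamma\in\Gamma$ with $\|\gamma\|_X\le n$. For functions $f_1,f_2$ on the positive integers with values in $[0,\infty]$, $f_1\preceq f_2$ means that there is a constant $C$ (a positive integer) such that $f_1(n)\le C f_2(Cn)$ for all $n\geq 1$. *)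

(* Defs.v *)
From HB Require Import structures.
From mathcomp Require Import all_boot all_order all_algebra finmap.
From mathcomp Require Import all_classical all_reals all_analysis.

Set Implicit Arguments.
Unset Strict Implicit.
Unset Printing Implicit Defensive.

Import Order.TTheory GRing.Theory Num.Theory.

Local Open Scope classical_set_scope.
Local Open Scope group_scope.

Definition free_basis (I : Type) (G : groupType) (b : I -> G) : Prop :=
  forall (H : groupType) (y : I -> H),
    exists f : {multiplicative G -> H},
      (forall i, f (b i) = y i) /\
      (forall f' : {multiplicative G -> H},
         (forall i, f' (b i) = y i) -> f' =1 f).

Definition free_of_rank (m : nat) (G : groupType) : Prop :=
  exists b : 'I_m -> G, free_basis b.

Section ResidualFinitenessGrowth.
Variables (R : realType) (G : groupType).
Implicit Types (X : {fset G}) (g : G) (w : seq G) (D : set G) (n : nat).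

(* w represents g as a word in the letters X and their inverses *)
Definition represents X w g : Prop :=
  all (fun x => (x \in X) || (x^-1 \in X)) w /\ \prod_(x <- w) x = g.

Definition generates X : Prop := forall g, exists w, represents X w g.

(* The infima below are over sets of natural numbers embedded in \bar R, so
   they are minima, or +oo when the set is empty. *)
Definition word_length X g : \bar R :=
  ereal_inf [set (size w)%:R%:E | w in [set w | represents X w g]].

Definition is_subgroup D : Prop := group_closed (mem D).

Definition left_cosets D : set (set G) :=
  [set [set g * d | d in D] | g in [set: G]].

Definition finite_index D : Prop := finite_set (left_cosets D).

(* junk value 0 if D does not have finite index *)
Definition subgroup_index D : nat := #|` fset_set (left_cosets D)|%fset.

Definition divisibility g : \bar R :=
  ereal_inf [set (subgroup_index D)%:R%:E |
             D in [set D | [/\ is_subgroup D, finite_index D & ~ D g]]].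

(* For n >= 1, finite X generating a nontrivial residually finite G, this is
   the supremum of a nonempty finite set, i.e. a maximum. *)
Definition max_divisibility X n : \bar R :=
  ereal_sup [set divisibility g |
             g in [set g | g <> 1 /\ (word_length X g <= n%:R%:E)%E]].

End ResidualFinitenessGrowth.

Definition growth_le (R : realType) (f1 f2 : nat -> \bar R) : Prop :=
  exists C : nat, (0 < C)%N /\
    forall n : nat, (0 < n)%N -> (f1 n <= C%:R%:E * f2 (C * n)%N)%E.

(* Main.v *)
(** A nontrivial element lying in every subgroup of index at most q^2 is
    built as follows. A permutation of at most q^2 points has at most q cycles
    of length greater than q, so it is killed by an exponent of the form
    q! * a_1 * ... * a_q with 1 <= a_i <= q^2. Combining the powers x^e, for
    all such e, in a balanced binary tree of commutators [u, y v y^-1] gives a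
    word of length 2^(O(q log q)) which acts trivially on the cosets of every
    subgroup of index at most q^2. Its logarithm is o(q^2), so the divisibility
    function is not dominated by log. A ping-pong argument shows that the word
    is nontrivial. *)

From HB Require Import structures.
Require Import Defs.
From mathcomp Require Import all_boot all_order all_algebra finmap.
From mathcomp Require Import perm zify ring lra.
From mathcomp Require Import all_classical all_reals all_analysis.

Set Implicit Arguments.
Unset Strict Implicit.
Unset Printing Implicit Defensive.

Import Order.TTheory GRing.Theory Num.Theory.

Local Open Scope classical_set_scope.
Local Open Scope group_scope.

(** * Exponents killing a permutation *)

Section PermutationExponents.
Variables (T : finType) (s : {perm T}).

Lemma trivIset_porbits : finset.trivIset (porbits s).
Proof.
apply/finset.trivIsetP => _ _ /imsetP[a _ ->] /imsetP[b _ ->].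
apply: contraNT => /pred0Pn[c /andP[/= ca cb]].
by move: ca cb; rewrite -!eq_porbit_mem => /eqP <- /eqP <-.
Qed.

(** The cycles are disjoint, and each one counted here occupies more than [q] of the points of
    [T]. *)
Lemma card_large_porbits (q : nat) :
  (#|[set c in porbits s | q < #|c|]%SET| * q <= #|T|)%N.
Proof.
set big := [set c in _ | _]%SET.
have sub : big \subset porbits s by apply/fintype.subsetP => c; rewrite inE => /andP[].
have /eqP cov : finset.trivIset big by exact: finset.trivIsetS sub trivIset_porbits.
apply: (@leq_trans #|finset.cover big|); last exact: max_card.
rewrite -cov -sum_nat_const; apply: leq_sum => c.
by rewrite inE => /andP[_ /ltnW].
Qed.

End PermutationExponents.

Definition exponent (q : nat) (t : {ffun 'I_q -> 'I_(q ^ 2)}) : nat :=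
  (q`! * \prod_(i < q) (t i).+1)%N.

Lemma exponent_gt0 (q : nat) (t : {ffun 'I_q -> 'I_(q ^ 2)}) :
  (0 < exponent t)%N.
Proof. by rewrite muln_gt0 fact_gt0 prodn_gt0. Qed.

Lemma fact_leq_exp (q : nat) : (q`! <= q ^ q)%N.
Proof.
suff H n : (n <= q -> n`! <= q ^ n)%N by exact: H.
by elim: n => // n IH nq; rewrite factS expnS leq_mul // IH // ltnW.
Qed.

Lemma exponent_leq (q : nat) (t : {ffun 'I_q -> 'I_(q ^ 2)}) :
  (exponent t <= q ^ (3 * q))%N.
Proof.
rewrite mulSn expnD leq_mul ?fact_leq_exp // expnM.
have -> : ((q ^ 2) ^ q = \prod_(i < q) q ^ 2)%N.
  by rewrite prod_nat_const card_ord.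
by apply: leq_prod => i _.
Qed.

Lemma perm_exponent (T : finType) (s : {perm T}) (q : nat) : (0 < q)%N ->
  (#|T| <= q ^ 2)%N ->
  exists t : {ffun 'I_q -> 'I_(q ^ 2)}, forall z, iter (exponent t) s z = z.
Proof.
move=> q0 Tq.
pose big := enum [set c in porbits s | q < #|c|]%SET.
have sbig : (size big <= q)%N.
  rewrite -cardE -(leq_pmul2r q0); apply: leq_trans (card_large_porbits s q) _.
  by rewrite mulnn.
have q20 : (0 < q ^ 2)%N by rewrite expn_gt0 q0.
(* Slot [i] stores the length of the [i]-th long cycle minus one, since [exponent] adds one back.
   Slots past the end of [big] read [set0] and give the factor 1. The default of [insubd] is never
   reached: a cycle has at most [q ^ 2] points. *)
exists [ffun i : 'I_q => insubd (Ordinal q20) #|nth finset.set0 big i|.-1] => z.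
suff /dvdnP[k ->] : #|porbit s z| %| exponent
    [ffun i : 'I_q => insubd (Ordinal q20) #|nth finset.set0 big i|.-1].
  elim: k => // k IH; rewrite mulSn iterD IH; exact: iter_porbit.
have L0 : (0 < #|porbit s z|)%N by rewrite lt0n card_porbit_neq0.
have [Lq|qL] := leqP #|porbit s z| q.
  by rewrite dvdn_mulr // dvdn_fact // L0.
have zbig : porbit s z \in big by rewrite mem_enum inE qL imset_f.
have iq : (index (porbit s z) big < q)%N.
  by apply: leq_trans sbig; rewrite index_mem.
rewrite dvdn_mull // (bigD1 (Ordinal iq)) //= dvdn_mulr // ffunE /=.
rewrite nth_index // val_insubd prednK // ifT ?prednK //.
exact: leq_trans (max_card _) Tq.
Qed.

(** * Trees of commutators *)

Section CommutatorTree.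
Variables (G : groupType) (x y : G).

(* The commutator of u and y v y^-1; the conjugation by x makes the pattern
   reproduce itself in the ping-pong argument. *)
Definition twist (u v : G) : G :=
  x * (u * (y * v * y^-1) * u^-1 * (y * v^-1 * y^-1)) * x^-1.

Fixpoint tree (d : nat) (f : nat -> G) : G :=
  if d is d'.+1 then twist (tree d' f) (tree d' (fun i => f (i + 2 ^ d')%N))
  else f 0.

Lemma tree_ind (P : G -> Prop) d f :
  (forall u v, P u -> P v -> P (twist u v)) -> (forall i, P (f i)) ->
  P (tree d f).
Proof. by move=> PM; elim: d f => [|d IH] f Pf /=; [|apply: PM; apply: IH]. Qed.

(** A commutator is trivial as soon as one entry is. For such an absorbing [P], one good leaf
    therefore propagates along its branch to the root. *)
Lemma tree_kill (P : G -> Prop) d f i :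
  (forall u v, P u \/ P v -> P (twist u v)) -> (i < 2 ^ d)%N -> P (f i) ->
  P (tree d f).
Proof.
move=> PM; elim: d f i => [|d IH] f i /=; first by case: i.
move=> id Pi; apply: PM; have [lt|ge] := ltnP i (2 ^ d).
  by left; exact: IH lt Pi.
right; apply: (IH _ (i - 2 ^ d)%N); last by rewrite subnK.
by rewrite ltn_subLR // addnn -mul2n -expnS.
Qed.

End CommutatorTree.

Lemma gmulf_tree (G H : groupType) (phi : UMagmaMorphism.type G H) x y d f :
  phi (tree x y d f) = tree (phi x) (phi y) d (phi \o f).
Proof.
elim: d f => [|d IH] f //=; rewrite /twist !(gmulfM, gmulfV).
by rewrite !IH.
Qed.

(** * Subgroups *)

Section Cosets.
Variables (G : groupType) (D : set G).
Hypothesis sgD : is_subgroup D.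

Let D1 : D 1. Proof. by have := sgD.1; rewrite inE. Qed.
Let DM g h : D g -> D h -> D (g * h).
Proof. by have /= := group_closedM sgD (x := g) (y := h); rewrite !inE. Qed.
Let DV g : D g -> D g^-1.
Proof. by have /= := group_closedV sgD (x := g); rewrite !inE. Qed.

(** The normal core of [D]. Passing to a normal subgroup is what lets a commutator be killed by a
    single entry. *)
Definition core : set G := [set g | forall h, D (h^-1 * g * h)].

Lemma core_sub g : core g -> D g.
Proof. by move/(_ 1); rewrite invg1 mul1g mulg1. Qed.

Lemma coreM g h : core g -> core h -> core (g * h).
Proof.
move=> cg ch k; suff -> : k^-1 * (g * h) * k = (k^-1 * g * k) * (k^-1 * h * k).
  by apply: DM; [exact: cg|exact: ch].
by rewrite !mulgA mulgK.
Qed.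

Lemma coreV g : core g -> core g^-1.
Proof.
move=> cg k; suff -> : k^-1 * g^-1 * k = (k^-1 * g * k)^-1 by exact/DV/cg.
by rewrite !invgM invgK mulgA.
Qed.

Lemma coreJ g h : core g -> core (h * g * h^-1).
Proof. by move=> cg k; have := cg (h^-1 * k); rewrite invgM invgK !mulgA. Qed.

(** With [w = y * v * y^-1], the commutator is [u] times a conjugate of [u^-1], and also a conjugate
    of [w] times [w^-1]. *)
Lemma core_twist x y u v : core u \/ core v -> core (twist x y u v).
Proof.
move=> cuv; apply: coreJ; case: cuv => [cu|cv].
  rewrite -!(mulgA u); apply: coreM => //.
  have -> : y * v^-1 * y^-1 = (y * v * y^-1)^-1 by rewrite !invgM invgK mulgA.
  exact/coreJ/coreV.
by apply: coreM; [do 2!apply: coreJ | apply/coreJ/coreV].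
Qed.

Definition translate (g : G) (B : set G) : set G := [set g * b | b in B].

Lemma translateM g h B : translate (g * h) B = translate g (translate h B).
Proof.
apply/seteqP; split=> [_ [b Bb <-]|_ [_ [b Bb <-] <-]].
  by exists (h * b); [exists b|rewrite mulgA].
by exists b; rewrite ?mulgA.
Qed.

Lemma translateK g : cancel (translate g) (translate g^-1).
Proof.
move=> B; rewrite -translateM mulVg; apply/seteqP; split=> [_ [b Bb <-]|b Bb].
  by rewrite mul1g.
by exists b; rewrite ?mul1g.
Qed.

Lemma translate_left_cosets g B : left_cosets D B -> left_cosets D (translate g B).
Proof. by move=> [h _ <-]; exists (g * h) => //; exact: translateM. Qed.

Lemma translate_core g :
  (forall B, left_cosets D B -> translate g B = B) -> core g.
Proof.
(* Since [h] lies in the coset [h D], invariance of this coset puts [g * h] in [h D]. *)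
move=> fix_g h; have lD : left_cosets D (translate h D) by exists h.
have : translate h D (g * h).
  by rewrite -(fix_g _ lD); exists h => //; exists 1; rewrite ?mulg1.
by move=> [d Dd] /(canRL (mulKg h)) dE; rewrite dE mulgA in Dd.
Qed.

(** Left translation by [x] permutes the at most [q ^ 2] left cosets. An exponent killing this
    permutation makes a power of [x] that fixes every coset, hence lies in the core. *)
Lemma exponent_core (q : nat) (x : G) : (0 < q)%N -> finite_index D ->
  (subgroup_index D <= q ^ 2)%N ->
  exists t : {ffun 'I_q -> 'I_(q ^ 2)}, core (x ^+ exponent t).
Proof.
move=> q0 finD; rewrite /subgroup_index => leq2.
pose S := fset_set (left_cosets D).
have SP B : (B \in S) <-> left_cosets D B by rewrite in_fset_set // inE.
have S_translate (B : S) : translate x (val B) \in S.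
  by apply/SP/translate_left_cosets/SP/valP.
have inj : injective (fun B : S => [` S_translate B]%fset).
  by move=> A B /(congr1 val) /= /(can_inj (translateK x)) /val_inj.
have leS : (#|{: S}| <= q ^ 2)%N by rewrite -cardfE.
have [t tP] := perm_exponent (perm inj) q0 leS.
exists t; apply: translate_core => B /SP SB.
rewrite -[RHS]/(val [` SB]%fset) -[in RHS](tP [` SB]%fset).
elim: (exponent t) => [|n IH] /=.
  by have := translateK 1 B; rewrite -translateM invg1 mulg1.
by rewrite permE /= expgS translateM IH.
Qed.

End Cosets.

(** * Ping-pong *)

Section PingPong.
Variables (H : groupType) (T : Type) (act : H -> T -> T) (A B : set T) (x y : H).
Hypothesis act1 : forall p, act 1 p = p.
Hypothesis actM : forall g h p, act (g * h) p = act g (act h p).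
Hypothesis disjAB : A `&` B = set0.
Hypothesis B0 : B !=set0.
Hypothesis xX : forall n, (0 < n)%N -> forall p, B p -> A (act (x ^+ n) p).
Hypothesis xXV : forall n, (0 < n)%N -> forall p, B p -> A (act (x ^- n) p).
Hypothesis yA : forall p, A p -> B (act y p).
Hypothesis yVA : forall p, A p -> B (act y^-1 p).

(** Sending [B] into [A] would not survive the conjugation by [x] in [twist]; allowing an arbitrary
    power of [x] next to [u] makes the property inductive. *)
Definition pong (u : H) : Prop :=
  forall n p, B p -> A (act (x ^+ n * u) p) /\ A (act (u^-1 * x ^- n) p).

Lemma pong_expg e : (0 < e)%N -> pong (x ^+ e).
Proof.
move=> e0 n p Bp; rewrite -expgnDr -invgM -expgnDr.
by split; [apply: xX|apply: xXV]; rewrite ?addn_gt0 ?e0 ?orbT.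
Qed.

Lemma pong_twist u v : pong u -> pong v -> pong (twist x y u v).
Proof.
move=> pu pv n p Bp.
have u0 z : B z -> A (act u z) by move=> /(pu 0)[]; rewrite expg0 mul1g.
have uV z : B z -> A (act u^-1 z).
  by move=> /(pu 0)[_]; rewrite expg0 invg1 mulg1.
have v0 z : B z -> A (act v z) by move=> /(pv 0)[]; rewrite expg0 mul1g.
have vV z : B z -> A (act v^-1 z).
  by move=> /(pv 0)[_]; rewrite expg0 invg1 mulg1.
have x1 z : B z -> A (act x z) by move=> Bz; have := xX (ltn0Sn 0) Bz; rewrite expg1.
have x1V z : B z -> A (act x^-1 z).
  by move=> Bz; have := xXV (ltn0Sn 0) Bz; rewrite expg1.
split.
  (* The outer [x] is absorbed into the power in front of [u]. The remaining factors, read from the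
     right, move the point alternately into [A] and into [B]. *)
  have -> : x ^+ n * twist x y u v =
      (x ^+ n.+1 * u) * (y * (v * (y^-1 * (u^-1 * (y * (v^-1 * (y^-1 * x^-1))))))).
    by rewrite /twist expgSr !mulgA.
  rewrite actM; apply: (pu n.+1 _ _).1; rewrite !actM.
  by apply/yA/v0/yVA/uV/yA/vV/yVA/x1V.
have -> : (twist x y u v)^-1 * x ^- n =
    x * (y * (v * (y^-1 * (u * (y * (v^-1 * (y^-1 * (u^-1 * x ^- n.+1)))))))).
  by rewrite /twist expgSr !invgM !invgK !mulgA.
have := (pu n.+1 p Bp).2; rewrite !actM => Az.
by apply/x1/yA/v0/yVA/u0/yA/vV/yVA.
Qed.

Lemma pong_neq1 u : pong u -> u <> 1.
Proof.
move=> pu u1; have [p Bp] := B0; have [+ _] := pu 0 p Bp.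
rewrite u1 expg0 mulg1 act1 => Ap.
by suff: (A `&` B) p by rewrite disjAB.
Qed.

End PingPong.

(** * The group of bijections of a type, under composition *)

Record bijection (T : Type) := Bijection {
  bfun : T -> T;
  binv : T -> T;
  bfunK : cancel bfun binv;
  binvK : cancel binv bfun
}.

HB.instance Definition _ T := gen_eqMixin (bijection T).
HB.instance Definition _ T := gen_choiceMixin (bijection T).

Section BijectionGroup.
Variable T : Type.
Implicit Types f g h : bijection T.

Lemma bijection_ext f g : bfun f =1 bfun g -> f = g.
Proof.
case: f g => f f' fK f'K [g g' gK g'K] /= /funext fg.
rewrite -fg in gK g'K *; have fg' : f' = g'.
  by apply/funext => p; rewrite -{1}[p]g'K fK.
by rewrite -fg' in gK g'K *; congr Bijection; exact: Prop_irrelevance.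
Qed.

Definition bijection_one : bijection T :=
  @Bijection T id id (fun=> erefl) (fun=> erefl).
Definition bijection_inv f : bijection T := Bijection (@binvK T f) (@bfunK T f).
Definition bijection_mul f g : bijection T :=
  Bijection (can_comp (@bfunK T f) (@bfunK T g))
            (can_comp (@binvK T g) (@binvK T f)).

Lemma bijection_mulA : associative bijection_mul.
Proof. by move=> f g h; exact: bijection_ext. Qed.
Lemma bijection_mul1 : left_id bijection_one bijection_mul.
Proof. by move=> f; exact: bijection_ext. Qed.
Lemma bijection_mulr1 : right_id bijection_one bijection_mul.
Proof. by move=> f; exact: bijection_ext. Qed.
Lemma bijection_mulV : left_inverse bijection_one bijection_inv bijection_mul.
Proof. by move=> f; apply: bijection_ext => p /=; rewrite bfunK. Qed.
Lemma bijection_mulrV : right_inverse bijection_one bijection_inv bijection_mul.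
Proof. by move=> f; apply: bijection_ext => p /=; rewrite binvK. Qed.

HB.instance Definition _ := isGroup.Build (bijection T)
  bijection_mulA bijection_mul1 bijection_mulr1 bijection_mulV bijection_mulrV.

End BijectionGroup.

(** * Ping-pong on the integer lattice *)

Section ShearSwap.
Local Open Scope ring_scope.

Let shearK : cancel (fun p : int * int => (p.1 + 2 * p.2, p.2))
                    (fun p : int * int => (p.1 - 2 * p.2, p.2)).
Proof. by case=> a b /=; rewrite addrK. Qed.
Let shearVK : cancel (fun p : int * int => (p.1 - 2 * p.2, p.2))
                     (fun p : int * int => (p.1 + 2 * p.2, p.2)).
Proof. by case=> a b /=; rewrite subrK. Qed.
Let swapK : involutive (fun p : int * int => (p.2, p.1)).
Proof. by case. Qed.

(** The matrices with rows (1 2), (0 1) and (0 1), (1 0). The order two of [swap] is harmless: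
    ping-pong only asks that [y] and its inverse send [A] into [B]. *)
Definition shear : bijection (int * int) := Bijection shearK shearVK.
Definition swap : bijection (int * int) := Bijection swapK swapK.

Lemma bfun_shearX n p : bfun (shear ^+ n)%g p = (p.1 + 2 * n%:R * p.2, p.2).
Proof.
elim: n => [|n IH]; first by case: p => a b /=; congr pair; ring.
by rewrite expgS /= IH /=; congr pair; rewrite -[n.+1]addn1 natrD; ring.
Qed.

Lemma bfun_shearXV n p : bfun (shear ^- n)%g p = (p.1 - 2 * n%:R * p.2, p.2).
Proof.
rewrite -[p in LHS](_ : bfun (shear ^+ n)%g (p.1 - 2 * n%:R * p.2, p.2) = p).
  exact: bfunK.
by rewrite bfun_shearX /= subrK -surjective_pairing.
Qed.

Lemma shear_swap_tree_neq1 d (e : nat -> nat) : (forall i, 0 < e i)%N ->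
  tree shear swap d (fun i => shear ^+ e i)%g <> 1%g.
Proof.
move=> e0; pose A := [set p : int * int | `|p.2| < `|p.1|].
pose B := [set p : int * int | `|p.1| < `|p.2|].
apply: (@pong_neq1 _ _ (@bfun _) A B shear) => //.
- by apply/seteqP; split=> // p [] /= /lt_trans /[apply]; rewrite ltxx.
- by exists (0, 1).
(* By the reverse triangle inequality the right side is at least [2 n |b| - |a|], which exceeds
   [|b|]; the entry 2 of the shear makes this work already for [n = 1]. *)
have shear_out (a b : int) n : (0 < n)%N -> `|a| < `|b| ->
    `|b| < `|a + 2 * n%:R * b|.
  move=> n0 ab; have := lerB_dist (2 * n%:R * b) (- a).
  rewrite opprK normrN addrC normrM [ `|2 * _| ]ger0_norm //.
  have : 1 <= n%:R :> int by rewrite ler1n.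
  have := normr_ge0 a; nia.
have shearA n : (0 < n)%N -> forall p, B p -> A (bfun (shear ^+ n)%g p).
  by move=> n0 p; rewrite bfun_shearX /A /=; exact: shear_out.
have shearVA n : (0 < n)%N -> forall p, B p -> A (bfun (shear ^- n)%g p).
  move=> n0 p; rewrite bfun_shearXV /A /B /=.
  by have := @shear_out p.1 (- p.2) n n0; rewrite normrN mulrN.
by apply: tree_ind => [u v|i]; [exact: pong_twist|exact: pong_expg].
Qed.

End ShearSwap.

(** Freeness gives a homomorphism taking [b i0] to the shear and every other generator to the swap;
    the image of the tree is nontrivial. *)
Lemma free_tree_neq1 m (G : groupType) (b : 'I_m -> G) (i0 i1 : 'I_m) d
    (e : nat -> nat) : free_basis b -> i0 != i1 -> (forall i, 0 < e i)%N ->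
  tree (b i0) (b i1) d (fun i => b i0 ^+ e i) <> 1.
Proof.
move=> bP i01 e0 eq1.
pose y i := if i == i0 then shear else swap.
have [phi phib] : exists phi : UMagmaMorphism.type G (bijection (int * int)),
    forall i, phi (b i) = y i.
  have [f [fb _]] := bP _ y.
  (* The universal property yields a merely multiplicative map; cancellation shows that it preserves
     1. *)
  have f1 : f 1 = 1 by apply: (mulgI (f 1)); rewrite -gmulfM !mulg1.
  by exists (HB.pack_for (UMagmaMorphism.type _ _) (f : _ -> _)
    (isUMagmaMorphism.Build _ _ (f : _ -> _) (f1, @gmulfM _ _ f))).
apply: (shear_swap_tree_neq1 (d := d) e0).
have := congr1 phi eq1; rewrite gmulf_tree gmulf1 !phib /y eqxx eq_sym.
rewrite (negbTE i01) => <-; congr tree; apply/funext => i /=.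
by rewrite gmulfXn phib /y eqxx.
Qed.

(** * Word length *)

Section WordLength.
Variables (G : groupType) (X : {fset G}).

Definition length_le (n : nat) (g : G) : Prop :=
  exists2 w, represents X w g & (size w <= n)%N.

Lemma length_leW n k g : (n <= k)%N -> length_le n g -> length_le k g.
Proof. by move=> nk [w wg wn]; exists w => //; exact: leq_trans nk. Qed.

Lemma length_leM n k g h :
  length_le n g -> length_le k h -> length_le (n + k) (g * h).
Proof.
move=> [w [wX wg] wn] [w' [wX' wg'] wk]; exists (w ++ w').
  by split; rewrite ?all_cat ?wX // big_cat /= wg wg'.
by rewrite size_cat leq_add.
Qed.

Lemma length_leV n g : length_le n g -> length_le n g^-1.
Proof.
move=> [w [wX <-] wn]; exists (rev (map (fun z => z^-1) w)); last first.
  by rewrite size_rev size_map.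
split.
  rewrite all_rev all_map; apply: sub_all wX => z /=.
  by rewrite invgK orbC.
elim: w {wX wn} => [|z w IH]; first by rewrite !big_nil invg1.
by rewrite /= rev_cons -cats1 big_cat big_seq1 IH big_cons invgM.
Qed.

Lemma length_leX n g e : length_le n g -> length_le (e * n) (g ^+ e).
Proof.
move=> gn; elim: e => [|e IH]; first by exists [::]; rewrite ?/represents ?big_nil.
by rewrite expgS mulSn; exact: length_leM.
Qed.

(** If [u] and [v] have length at most [l], their twist has length at most [4 l + 6 L]. Thus
    [l + 2 L] is multiplied by 4 at each level. *)
Lemma length_le_tree L M x y d f : length_le L x -> length_le L y ->
  (forall i, length_le M (f i)) ->
  length_le (4 ^ d * (M + 2 * L) - 2 * L) (tree x y d f).
Proof.
move=> xL yL; elim: d f => [|d IH] f fM /=; first by rewrite expn0 mul1n addnK.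
have yV := length_leV yL; have xV := length_leV xL.
set u := tree _ _ _ f; set v := tree _ _ _ _.
have hu : length_le _ u := IH _ fM.
have hv : length_le _ v := IH _ (fun i => fM _).
have hw := length_leM (length_leM yL hv) yV.
have hw' := length_leM (length_leM yL (length_leV hv)) yV.
have := length_leM (length_leM xL (length_leM (length_leM
  (length_leM hu hw) (length_leV hu)) hw')) xV.
apply: length_leW; rewrite expnS.
have : (0 < 4 ^ d)%N by rewrite expn_gt0.
nia.
Qed.

End WordLength.

(** * Elements of large divisibility *)

Section Witness.
Variables (R : realType) (G : groupType) (X : {fset G}).

Lemma word_length_le n g : length_le X n g -> (word_length R X g <= n%:R%:E)%E.
Proof.
move=> [w wg wn]; apply: (@le_trans _ _ (size w)%:R%:E).
  by apply: ereal_inf_lbound; exists w.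
by rewrite lee_fin ler_nat.
Qed.

Lemma max_divisibility_ge n k g : g <> 1 -> length_le X n g ->
  (forall D, is_subgroup D -> finite_index D -> (subgroup_index D <= k)%N ->
     D g) ->
  (k%:R%:E <= max_divisibility R X n)%E.
Proof.
move=> g1 gn gD; apply: (@le_trans _ _ (divisibility R g)).
  apply: le_ereal_inf_tmp => _ [D [sD fD nDg] <-].
  by rewrite lee_fin ler_nat ltnW // ltnNge; apply/negP => /(gD D sD fD).
by apply: ereal_sup_ubound; exists g => //; split => //; exact: word_length_le.
Qed.

Lemma max_divisibility_free m r L (b : 'I_m -> G) (i0 i1 : 'I_m) :
  free_basis b -> i0 != i1 -> length_le X L (b i0) -> length_le X L (b i1) ->
  (((2 ^ r) ^ 2)%:R%:E <=
   max_divisibility R X (2 ^ (7 * (r * 2 ^ r)) * (3 * L)))%E.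
Proof.
move=> bP i01 L0 L1; pose q := (2 ^ r)%N.
have q0 : (0 < q)%N by rewrite expn_gt0.
pose E := [seq exponent t | t : {ffun 'I_q -> 'I_(q ^ 2)}].
(* The default 1 keeps [e i] positive and within the bound beyond the end of [E]. *)
pose e i := nth 1%N E i.
(* As [q] is a power of two, the number [q ^ (2 q)] of exponents is one too, so they fill the leaves
   of a tree of depth [2 r q] exactly. *)
have sE : (size E = 2 ^ (2 * (r * q)))%N.
  rewrite size_map -cardE card_ffun !card_ord /q -!expnM; congr expn.
  by lia.
have eP i : (0 < e i <= 2 ^ (3 * (r * q)))%N.
  have [lt|ge] := ltnP i (size E); last by rewrite /e nth_default // expn_gt0.
  have /mapP[t _ ->] : e i \in E by exact: mem_nth.
  rewrite exponent_gt0 (leq_trans (exponent_leq t)) // {1}/q -expnM.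
  by rewrite leq_exp2l //; lia.
pose g := tree (b i0) (b i1) (2 * (r * q)) (fun i => b i0 ^+ e i).
apply: (@max_divisibility_ge _ _ g).
- by apply: free_tree_neq1 => // i; case/andP: (eP i).
- have fM i : length_le X (2 ^ (3 * (r * q)) * L) (b i0 ^+ e i).
    apply: length_leW (length_leX (e i) L0).
    by rewrite leq_mul2r; case/andP: (eP i) => _ ->; rewrite orbT.
  apply: length_leW (length_le_tree (2 * (r * q)) L0 L1 fM).
  apply: leq_trans (leq_subr _ _) _.
  have -> : (4 ^ (2 * (r * q)) = 2 ^ (4 * (r * q)))%N.
    by rewrite -[4%N]/(2 ^ 2)%N -expnM; congr expn; lia.
  have -> : (7 * (r * q) = 4 * (r * q) + 3 * (r * q))%N by lia.
  rewrite expnD -mulnA leq_mul2l; apply/orP; right.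
  (* The summand [2 * L] is at most [2 ^ (3 * (r * q)) * (2 * L)], whence the factor 3. *)
  have : (0 < 2 ^ (3 * (r * q)))%N by rewrite expn_gt0.
  by nia.
move=> D sD fD iD; apply: (core_sub (D := D)).
have [t tD] := exponent_core sD (b i0) q0 fD iD.
have tE : exponent t \in E by rewrite map_f ?mem_enum.
apply: (@tree_kill _ _ _ (core D) _ _ (index (exponent t) E)).
- exact: core_twist.
- by rewrite -sE index_mem.
- by rewrite /e nth_index.
Qed.

End Witness.

(** * Comparison with the logarithm *)

Lemma ln_pow2_le (R : realType) n k :
  (n <= 2 ^ k)%N -> (ln (n%:R : R) <= k%:R)%R.
Proof.
case: n => [_|n nk]; first by rewrite ln0.
apply: (@le_trans _ _ (ln ((2 ^+ k)%R : R))).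
  by rewrite ler_ln ?posrE ?exprn_gt0 ?ltr0n // -natrX ler_nat.
rewrite lnXn // -[leRHS]mulr_natr mul1r -[leLHS]mulr_natr.
by rewrite ler_piMl //; have := @le_ln1Dx R 1; apply; lra.
Qed.

(** For [r = 2 t] and [Q = 2 ^ t], the left side is at most [C (14 + s) t Q^2 = t^2 Q^2], and
    [t < Q]. *)
Lemma square_gt_linearithmic (C s : nat) : (0 < C)%N ->
  exists r, (C * (7 * (r * 2 ^ r) + s) < (2 ^ r) ^ 2)%N.
Proof.
move=> C0; pose t := (C * (14 + s))%N; exists (2 * t)%N.
have t2 : (t < 2 ^ t)%N by exact: ltn_expl.
have -> : (2 ^ (2 * t) = 2 ^ t * 2 ^ t)%N by rewrite mul2n -addnn expnD.
move: (2 ^ t)%N t2 => Q tQ.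
have t0 : (0 < t)%N by rewrite muln_gt0 C0.
apply: (@leq_ltn_trans (t * t * (Q * Q))); last first.
  by rewrite -mulnn ltn_mul2r ltn_mul // !muln_gt0 (leq_trans _ tQ).
have -> : (t * t * (Q * Q) = C * (14 * (t * (Q * Q)) + s * (t * (Q * Q))))%N.
  by rewrite {1}/t; lia.
rewrite leq_mul2l leq_add ?orbT //; first by lia.
by rewrite leq_pmulr // (muln_gt0 t) t0 muln_gt0 (leq_trans _ tQ).
Qed.

Theorem theorem1p4 (R : realType) (m : nat) (Fm : groupType) (X : {fset Fm}) :
  (1 < m)%N -> free_of_rank m Fm -> generates X ->
  ~ growth_le (max_divisibility R X) (fun n : nat => (ln (n%:R : R))%:E).
Proof.
move=> m1 [b bP] genX [C [C0 leC]].
pose i0 := Ordinal (ltnW m1); pose i1 := Ordinal m1.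
have [w0 w0P] := genX (b i0); have [w1 w1P] := genX (b i1).
pose L := (size w0 + size w1).+1.
have L0 : length_le X L (b i0) by exists w0; rewrite // ltnW // ltnS leq_addr.
have L1 : length_le X L (b i1) by exists w1; rewrite // ltnW // ltnS leq_addl.
have [r] := square_gt_linearithmic (C * (3 * L)) C0.
set s := (C * (3 * L))%N; set N := (7 * (r * 2 ^ r))%N; apply/negP; rewrite -leqNgt.
have n0 : (0 < 2 ^ N * (3 * L))%N by rewrite !muln_gt0 expn_gt0.
have := le_trans (max_divisibility_free R r bP (isT : i0 != i1) L0 L1) (leC _ n0).
rewrite -EFinM lee_fin => le1; rewrite -(ler_nat R); apply: le_trans le1 _.
(* The argument of the logarithm is [2 ^ N * s], at most [2 ^ (N + s)] because [s < 2 ^ s]; its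
   logarithm is then at most [N + s]. *)
rewrite [leRHS]natrM ler_wpM2l // ln_pow2_le // mulnCA -/s expnD leq_mul2l.
by rewrite (ltnW (ltn_expl s _)) ?orbT.
Qed.
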